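(* Let $\|\cdot\|$ be an arbitrary norm on $\mathbb{R}^n$, and let $C\subset\mathbb{R}^n$ be a nonempty convex set. If there exists a constant $\sigma>0$ such that the norm function $f(x)=\|x\|$ is $\sigma$-strongly quasiconvex on $C$, then $C$ is bounded.
   Context: Let $C\subset\mathbb{R}^n$ be a nonempty convex set and $\sigma>0$. A function $f\colon C\to[-\infty,\infty]$ is $\sigma$-strongly quasiconvex on $C$ if $$f(\lambda x+(1-\lambda)y)\le\max\{f(x),f(y)\}-\frac{\sigma}{2}\lambda(1-\lambda)\|x-y\|_2^2$$ for all $x,y\in C$ and all $\lambda\in(0,1)$. Here $\|\cdot\|_2$ is the Euclidean norm, which is always the norm used in the last term, regardless of the norm $\|\cdot\|$ under consideration. *)

(* Defs.v *)
From mathcomp Require Import all_boot all_order all_algebra.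
From mathcomp Require Import all_classical all_reals all_analysis.

Set Implicit Arguments.
Unset Strict Implicit.
Unset Printing Implicit Defensive.

Import Order.TTheory GRing.Theory Num.Theory.
Import numFieldNormedType.Exports.

Local Open Scope classical_set_scope.
Local Open Scope ring_scope.

(* The library norm `|x| on 'rV[R]_n is the sup norm; an arbitrary norm is
   therefore a function together with this predicate. *)
Record is_norm (R : realType) (n : nat) (N : 'rV[R]_n -> R) : Prop := IsNorm {
  is_norm_ge0 : forall x, 0 <= N x ;
  is_norm_eq0 : forall x, N x = 0 -> x = 0 ;
  is_normZ : forall a x, N (a *: x) = `|a| * N x ;
  is_normD : forall x y, N (x + y) <= N x + N y }.

Definition norm2 (R : realType) (n : nat) (x : 'rV[R]_n) : R :=
  Num.sqrt (\sum_(i < n) x 0 i ^+ 2).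

(* A function C -> [-oo, +oo] is represented by a total function of which only
   the values on C matter, C being convex. *)
Definition strongly_quasiconvex (R : realType) (n : nat) (C : set 'rV[R]_n)
    (sigma : R) (f : 'rV[R]_n -> \bar R) : Prop :=
  forall (x y : 'rV[R]_n) (lambda : R), C x -> C y -> 0 < lambda < 1 ->
  (f (lambda *: x + (1 - lambda) *: y)%R <=
    maxe (f x) (f y) -
    (sigma / 2 * lambda * (1 - lambda) * norm2 (x - y) ^+ 2)%:E)%E.

(* Main.v *)
(** Strong quasiconvexity at the midpoint, together with [N >= 0], gives
    [sigma / 8 * norm2 (x - y) ^+ 2 <= max (N x) (N y)].  With [x] fixed, the
    right-hand side grows at most linearly in the distance from [x] to [y],
    which bounds that distance. *)
Require Import Defs.
From mathcomp Require Import all_boot all_order all_algebra.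
From mathcomp Require Import all_classical all_reals all_analysis.
From mathcomp Require Import ring lra.

Set Implicit Arguments.
Unset Strict Implicit.
Unset Printing Implicit Defensive.

Import Order.TTheory GRing.Theory Num.Theory.
Import numFieldNormedType.Exports.

Local Open Scope classical_set_scope.
Local Open Scope ring_scope.

Lemma norm_coord_le (R : realType) (n : nat) (x : 'rV[R]_n) (i : 'I_n) :
  `|x 0 i| <= `|x|.
Proof.
rewrite [leRHS]/Num.norm /= mx_normrE.
by apply/bigmax_geP; right => /=; exists (0, i).
Qed.

(** The square of each coordinate is one of the nonnegative terms under the root. This passes from
    the Euclidean penalty to the sup norm, in which [bounded_set] is stated. *)
Lemma norm_le_norm2 (R : realType) (n : nat) (x : 'rV[R]_n) :
  `|x| <= norm2 x.
Proof.
rewrite [leLHS]/Num.norm /= mx_normrE; apply/bigmax_leP.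
split=> [|[i j] _ /=]; first exact: sqrtr_ge0.
rewrite ord1 -sqrtr_sqr; apply: ler_wsqrtr.
by rewrite (bigD1 j)//= lerDl sumr_ge0// => k _; exact: sqr_ge0.
Qed.

(** Expand [x] in the standard basis and apply the triangle inequality; each coordinate is at most
    the sup norm. This is the source of the linear growth of [N]. *)
Lemma is_norm_le_norm (R : realType) (n : nat) (N : 'rV[R]_n -> R)
    (x : 'rV[R]_n) :
  is_norm N -> N x <= (\sum_(i < n) N (delta_mx 0 i)) * `|x|.
Proof.
move=> [N_ge0 _ NZ ND]; rewrite {1}(row_sum_delta x) mulr_suml.
elim/big_ind2: _ => [|u a v b ua vb|i _].
(* The empty sum needs [N 0 = 0], which comes from homogeneity with scalar 0. *)
- by rewrite -(scale0r (0 : 'rV[R]_n)) NZ normr0 mul0r.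
- exact: le_trans (ND _ _) (lerD ua vb).
- by rewrite NZ mulrC ler_wpM2l// norm_coord_le.
Qed.

Lemma strongly_quasiconvex_midpoint (R : realType) (n : nat)
    (N : 'rV[R]_n -> R) (C : set 'rV[R]_n) (sigma : R) (x y : 'rV[R]_n) :
  (forall z, 0 <= N z) ->
  strongly_quasiconvex C sigma (fun z => (N z)%:E) -> C x -> C y ->
  sigma / 8 * norm2 (x - y) ^+ 2 <= Num.max (N x) (N y).
Proof.
move=> N_ge0 qcN Cx Cy.
have half01 : 0 < (2^-1 : R) < 1 by apply/andP; split; lra.
have := qcN x y _ Cx Cy half01.
rewrite -EFin_max -EFinB lee_fin => /(le_trans (N_ge0 _)).
rewrite subr_ge0; apply: le_trans.
(* The two sides are equal: [sigma / 2 * lambda * (1 - lambda)] is [sigma / 8] at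
   [lambda = 2^-1]. *)
by rewrite le_eqVlt; apply/orP; left; apply/eqP; field.
Qed.

Theorem theorem2p5 (R : realType) (n : nat) (N : 'rV[R]_n -> R)
    (C : set 'rV[R]_n) :
  is_norm N -> C !=set0 -> convex_set C ->
  (exists2 sigma : R, 0 < sigma &
     strongly_quasiconvex C sigma (fun x => (N x)%:E)) ->
  bounded_set C.
Proof.
move=> normN [x Cx] _ [sigma sigma_gt0 qcN].
have [N_ge0 _ _ ND] := normN.
set L := \sum_(i < n) N (delta_mx 0 i).
have L_ge0 : 0 <= L by apply: sumr_ge0.
(* The summand 1 covers distances at most 1; the other summand bounds those above 1. *)
set K := 1 + 8 / sigma * (N x + L).
have dist_le y : C y -> `|y - x| <= K.
  move=> Cy; set t := `|y - x|.
  have t_ge0 : 0 <= t by exact: normr_ge0.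
  have Nyx : N (y - x) <= L * t by exact: is_norm_le_norm.
  have Ny : N y <= N (y - x) + N x by rewrite -{1}(subrK x y).
  have quad : sigma / 8 * t ^+ 2 <= N x + L * t.
    have max_le : Num.max (N y) (N x) <= N x + L * t.
      by rewrite ge_max; apply/andP; split; [lra|rewrite lerDl mulr_ge0].
    apply: le_trans (le_trans (strongly_quasiconvex_midpoint N_ge0 qcN Cy Cx)
      max_le).
    rewrite ler_wpM2l//; first by rewrite divr_ge0// ltW.
    by rewrite lerXn2r ?nnegrE ?sqrtr_ge0// norm_le_norm2.
  have NL_ge0 : 0 <= 8 / sigma * (N x + L).
    by rewrite mulr_ge0 ?addr_ge0// divr_ge0// ltW.
  have [t_le1|t_gt1] := leP t 1; first by rewrite /K; lra.
  (* since [t > 1], [N x + L * t <= (N x + L) * t] and a factor [t] cancels *)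
  have lin : sigma / 8 * t <= N x + L.
    rewrite -(ler_pM2r (lt_trans ltr01 t_gt1)) -[leLHS]mulrA -expr2.
    apply: le_trans quad _.
    by rewrite mulrDl lerD2r ler_peMr// ltW.
  suff : t <= 8 / sigma * (N x + L) by rewrite /K; lra.
  by rewrite mulrAC ler_pdivlMr//; lra.
(* The ball of radius [K] around [x] lies in the ball of this radius around 0. *)
exists (K + `|x|); split; first exact: num_real.
move=> M /ltW KxM y Cy /=; apply: le_trans KxM.
rewrite -[in leLHS](subrK x y).
exact: le_trans (ler_normD _ _) (lerD (dist_le y Cy) (lexx _)).
Qed.
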